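(* Let $j\in\{1,2\}$. Let $a_{1}>0$ be a rational number and let $a_{2}=0$. For every $\epsilon>0$ and every interval $[b_1,b_2]\subset\mathbb{R}$ with $b_1<b_2$ there exist (for some dimension $d$) a rational quadratic form $Q$ on $\mathbb{R}^d$ and an irrational linear form $L$ on $\mathbb{R}^d$ with $\operatorname{Stab}_{SO(Q)}(L)\cong SO(j,2)$ such that for an infinite sequence $T_{k}\rightarrow\infty$, \[ \left|\left\{v\in\mathbb{Z}^d: Q(v)=a_j,\ L(v)\in[b_1,b_2],\ \|v\|\le T_k\right\}\right|>T_{k}^{\,j}(\log T_{k})^{1-\epsilon}. \]
   Context: $\|\cdot\|$ is the Euclidean norm. A rational quadratic form is one with rational coefficients. A linear form $L$ is irrational if no nonzero scalar multiple of $L$ has rational coefficients. $SO(Q)$ is the special orthogonal group of $Q$ over $\mathbb{R}$, and $\operatorname{Stab}_{SO(Q)}(L)=\{x\in SO(Q):L(xv)=L(v)\ \forall v\}$. *)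

(* Defs.v *)
From mathcomp Require Import all_boot all_order all_algebra.
From mathcomp Require Import all_classical all_reals all_analysis.

Set Implicit Arguments.
Unset Strict Implicit.
Unset Printing Implicit Defensive.

Import Order.TTheory GRing.Theory Num.Theory.
Import numFieldNormedType.Exports.

Local Open Scope classical_set_scope.
Local Open Scope ring_scope.

(* A quadratic form on R^d is given by its (symmetric) Gram matrix A, a linear
   form by its row l of coefficients; vectors of R^d are columns. *)
Definition quad_form (R : realType) (d : nat) (A : 'M[R]_d) (v : 'cV[R]_d) : R :=
  (v^T *m A *m v) 0 0.

Definition lin_form (R : realType) (d : nat) (l : 'rV[R]_d) (v : 'cV[R]_d) : R :=
  (l *m v) 0 0.

Definition nondegenerate_quad_form (R : realType) (d : nat) (A : 'M[R]_d) : Prop :=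
  A^T = A /\ A \in unitmx.

(* The monomial coefficients of the form are A i i and 2 * A i j for i < j, so
   they are rational if and only if the entries of A are. *)
Definition rational_quad_form (R : realType) (d : nat) (A : 'M[R]_d) : Prop :=
  forall i j, rational (A i j).

Definition irrational_lin_form (R : realType) (d : nat) (l : 'rV[R]_d) : Prop :=
  forall c : R, c != 0 -> ~ (forall i, rational ((c *: l) 0 i)).

Definition SO (R : realType) (d : nat) (A : 'M[R]_d) : set 'M[R]_d :=
  [set x | \det x = 1 /\
           forall v : 'cV[R]_d, quad_form A (x *m v) = quad_form A v].

Definition Stab_SO (R : realType) (d : nat) (A : 'M[R]_d) (l : 'rV[R]_d) :
    set 'M[R]_d :=
  [set x | SO A x /\
           forall v : 'cV[R]_d, lin_form l (x *m v) = lin_form l v].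

Definition SOpq (R : realType) (p q : nat) : set 'M[R]_(p + q) :=
  SO (block_mx 1%:M 0 0 (- 1%:M)).

(* Isomorphism of matrix groups G and H as topological groups.  For closed
   subgroups of GL this is the same as isomorphism of Lie groups. *)
Definition matrix_group_iso (R : realType) (m n : nat)
    (G : set 'M[R]_m) (H : set 'M[R]_n) : Prop :=
  exists (f : 'M[R]_m -> 'M[R]_n) (g : 'M[R]_n -> 'M[R]_m),
    [/\ (forall x, G x -> H (f x) /\ g (f x) = x),
        (forall y, H y -> G (g y) /\ f (g y) = y),
        (forall x y, G x -> G y -> f (x *m y) = f x *m f y),
        {within G, continuous f} &
        {within H, continuous g}].

(* The matrix norm of the library is the sup norm, hence this definition. *)
Definition euclid_norm (R : realType) (d : nat) (v : 'cV[R]_d) : R :=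
  Num.sqrt (\sum_i v i 0 ^+ 2).

Definition int_vec (R : realType) (d : nat) (v : 'cV[int]_d) : 'cV[R]_d :=
  map_mx intr v.

Definition int_points (R : realType) (d : nat) (A : 'M[R]_d) (l : 'rV[R]_d)
    (a b1 b2 T : R) : set 'cV[int]_d :=
  [set v | [/\ quad_form A (int_vec R v) = a,
               b1 <= lin_form l (int_vec R v) <= b2 &
               euclid_norm (int_vec R v) <= T]].

(* Main.v *)
Require Import Defs.
From mathcomp Require Import all_boot all_order all_algebra finmap.
From mathcomp Require Import cyclic ring lra zify.
From mathcomp Require Import all_classical all_reals all_analysis.

Set Implicit Arguments.
Unset Strict Implicit.
Unset Printing Implicit Defensive.

Import Order.TTheory GRing.Theory Num.Theory.
Import numFieldNormedType.Exports.
Local Open Scope classical_set_scope.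
Local Open Scope ring_scope.

(** The point of the theorem is that a linear form [L] which is irrational, but
    extremely well approximated by rational forms, can have far more solutions
    than equidistribution predicts.

    Fix the form [D] of signature (j,2) plus one further negative square, with
    coordinates [v_0] (positive), [v_j] (the first negative one) and [w] (last),
    and put [X = v_j - v_0], an isotropic linear form; [Q] is [-a1 * D].  For
    every real [alpha] the form [w - alpha * X] is the image of [w] under an
    element of SO(D), an Eichler transvection, so its stabilizer is conjugate to
    the stabilizer of [w], which is SO(j,2) ([Stab_SO_iso]).

    When [alpha = p/q] is rational, the equation [w = alpha * X] cuts out a form
    in j+2 variables which, up to sublattices, is [x y + z^2] for j = 1 and
    [x y - z u] for j = 2.  Then the equation [Q = a1], resp. [Q = 0], becomes
    [t y' = z' (q^2 z' + 1)], resp. [t y' = z' u].  Such factorization problems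
    have at least a constant times [Y^j ln Y] solutions of size [Y]
    ([many_points1], [many_points2]); the logarithm is the divergence of the sum
    of [totient g / g^2] ([totient_sum_ge_ln]).

    Now let [alpha] be a Liouville number with a very good approximation [p/q]
    and [delta = alpha - p/q > 0].  The points found for [p/q] satisfy
    [w - alpha * X = - delta * X]; choosing the scale [Y = 1/delta] and asking
    that [X] lie between two multiples of [Y] places the value of the form in the
    prescribed interval.  The constants depend on [q] alone, so if [delta] is
    small enough in terms of [q], a factor [(ln Y)^eps] beats them
    ([powR_ln_lt]).  Such numbers [alpha] are built in [liouville_exists]. *)

(** * The divergent totient sum *)

Section TotientSum.
Variable R : realType.

Lemma sum_inv_squares_le2 (n : nat) :
  \sum_(1 <= m < n.+1) (m%:R ^+ 2)^-1 <= 2 :> R.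
Proof.
case: n => [|n]; first by rewrite big_geq.
suff : \sum_(1 <= m < n.+2) (m%:R ^+ 2)^-1 <= 2 - n.+1%:R^-1 :> R.
  by move=> h; apply: (le_trans h); rewrite gerBl invr_ge0.
elim: n => [|n IH]; first by rewrite big_nat1 expr1n; lra.
rewrite big_nat_recr //=; apply: (le_trans (lerD IH (lexx _))).
have n0 : 0 < n.+1%:R :> R by [].
have -> : n.+2%:R = n.+1%:R + 1 :> R by rewrite natr1.
move: (n.+1%:R) n0 => x x0.
have -> : (x + 1)^-1 = x^-1 - (x * (x + 1))^-1 by field; lra.
have : (x + 1) ^- 2 <= (x * (x + 1))^-1.
  have x1 : 0 < x + 1 by lra.
  by rewrite lef_pV2 ?posrE ?exprn_gt0 ?mulr_gt0 // expr2 ler_pM2r // lerDl.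
lra.
Qed.

(** Induction on the upper bound: the quotient by [d] grows exactly at the
    multiples of [d]. *)
Lemma sum_multiples_inv_squares (d n : nat) : (0 < d)%N ->
  \sum_(1 <= k < n.+1 | (d %| k)%N) (k%:R ^+ 2)^-1
  = (d%:R ^+ 2)^-1 * \sum_(1 <= m < (n %/ d).+1) (m%:R ^+ 2)^-1 :> R.
Proof.
move=> d0; elim: n => [|n IH].
  by rewrite div0n !big_geq // mulr0.
rewrite big_mkcond big_nat_recr //= -big_mkcond IH divnS //.
case: ifPn => [dn|_] /=; last by rewrite add0n addr0.
rewrite add1n [in RHS]big_nat_recr //=. rewrite mulrDr; congr (_ + _).
have -> : (n %/ d).+1 = (n.+1 %/ d)%N by rewrite divnS // dn.
by rewrite -invfM -exprMn -natrM mulnC divnK.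
Qed.

(** Gauss's identity writes [1/k] as the sum of [totient d / k^2] over the
    divisors [d] of [k]; after exchanging the sums, the multiples of [d]
    contribute at most [2 / d^2]. *)
Lemma harmonic_le_totient_sum (n : nat) :
  \sum_(1 <= k < n.+1) k%:R^-1
  <= 2 * \sum_(1 <= d < n.+1) (totient d)%:R / d%:R ^+ 2 :> R.
Proof.
have step k : (1 <= k < n.+1)%N -> k%:R^-1 =
    \sum_(1 <= d < n.+1) (if (d %| k)%N then (totient d)%:R / k%:R ^+ 2 else 0) :> R.
  move=> /andP[k0 kn]; rewrite -big_mkcond /= -mulr_suml.
  have -> : \sum_(1 <= d < n.+1 | (d %| k)%N) (totient d)%:R = k%:R :> R.
    rewrite -natr_sum -[in RHS](sum_totient_dvd k); congr (_%:R).
    rewrite -(big_mkord (fun d => d %| k)%N totient) [in RHS]big_ltn_cond //.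
    rewrite dvd0n gtn_eqF // (big_cat_nat (n := k.+1)) //= [X in (_ + X)%N]big1_seq ?addn0 //.
    move=> d /andP[dk]; rewrite mem_index_iota => /andP[kd _].
    by have := dvdn_leq k0 dk; lia.
  by field; rewrite pnatr_eq0; lia.
rewrite (eq_big_nat _ _ step) exchange_big /= mulr_sumr.
apply: ler_sum_nat => d /andP[d0 dn].
rewrite -big_mkcond /= -mulr_sumr sum_multiples_inv_squares //.
rewrite [leRHS]mulrC mulrA.
by apply: ler_wpM2l; rewrite ?divr_ge0 ?exprn_ge0 // ?sum_inv_squares_le2.
Qed.

Lemma ln_le_harmonic (n : nat) : ln n.+1%:R <= \sum_(1 <= k < n.+1) k%:R^-1 :> R.
Proof.
elim: n => [|n IH]; first by rewrite ln1 big_geq.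
rewrite big_nat_recr //=.
have -> : n.+2%:R = n.+1%:R * (1 + n.+1%:R^-1) :> R.
  by rewrite mulrDr mulr1 mulfV ?pnatr_eq0 // natr1.
have p : 0 < n.+1%:R^-1 :> R by rewrite invr_gt0.
have q : 0 < 1 + n.+1%:R^-1 :> R by rewrite addr_gt0.
rewrite lnM ?posrE ?ltr0n //.
by apply: lerD => //; apply: le_ln1Dx; exact: lt_trans p.
Qed.

(** The truncation is at the fourth root of [Y]: the logarithm survives up to a
    constant, while every interval of length about [Y / g] with [g <= G] is still
    much longer than [g]. *)
Lemma totient_sum_ge_ln (Y : R) : 1 <= Y -> exists G : nat,
  (0 < G)%N /\ G%:R ^+ 4 <= Y /\
  ln Y / 8 <= \sum_(1 <= d < G.+1) (totient d)%:R / d%:R ^+ 2.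
Proof.
move=> Y1; have Y0 : 0 < Y by lra.
pose y := Num.sqrt (Num.sqrt Y).
have y4 : y ^+ 4 = Y by rewrite (exprM y 2 2) !sqr_sqrtr ?sqrtr_ge0 // ltW.
have y0 : 0 <= y by apply: sqrtr_ge0.
have y1 : 1 <= y.
  by rewrite leNgt; apply/negP => h; have : y ^+ 4 < 1 by [rewrite exprn_ilt1]; lra.
exists (Num.truncn y).
have /andP[tl tu] := truncn_itv y0.
split; first by rewrite truncn_gt0.
split; first by rewrite -y4 lerXn2r ?nnegrE.
have := harmonic_le_totient_sum (Num.truncn y); have := ln_le_harmonic (Num.truncn y).
have yp : 0 < y by lra.
have : ln Y = 4 * ln y by rewrite -y4 lnXn // mulr_natl.
have : ln y <= ln (Num.truncn y).+1%:R by rewrite ler_ln ?posrE ?ltr0n // ltW.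
lra.
Qed.
End TotientSum.

(** * Integers of an interval coprime to a modulus *)

Lemma totient_count (M : nat) : totient M = count (coprime M) (iota 0 M).
Proof.
rewrite totient_count_coprime -sum1_count [RHS]big_mkcond /= /index_iota subn0.
by apply: eq_bigr => i _; case: coprime.
Qed.

(** Moving the window by one drops [B] and adds [B + M], which have the same gcd
    with [M]. *)
Lemma count_coprime_period (M B : nat) : count (coprime M) (iota B M) = totient M.
Proof.
elim: B => [|B <-]; first by rewrite totient_count.
apply/eqP; rewrite -(eqn_add2l (coprime M B)).
have -> : (coprime M B + count (coprime M) (iota B.+1 M))%N =
          count (coprime M) (iota B M.+1) by [].
by rewrite -addn1 iotaD count_cat /= addn0 addnC /coprime gcdnDr.
Qed.

Lemma count_coprime_blocks (M B k : nat) :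
  count (coprime M) (iota B (k * M)) = (k * totient M)%N.
Proof.
elim: k B => [|k IH] B; first by rewrite !mul0n.
by rewrite !mulSn iotaD count_cat IH count_coprime_period.
Qed.

(** For even [a], an integer coprime to [a] is odd, hence also coprime to
    [2 * a]. *)
Lemma totient_le_double (a : nat) : (0 < a)%N -> (totient a <= totient (2 * a))%N.
Proof.
move=> a0; have [a2|a2] := boolP (2 %| a)%N; last first.
  by rewrite totient_coprime ?mul1n // prime_coprime.
rewrite !totient_count mul2n -addnn iotaD count_cat.
apply: leq_trans (leq_addr _ _).
apply: sub_count => b ab; rewrite addnn -mul2n.
by rewrite coprimeMl ab andbT (coprime_dvdl a2 ab).
Qed.

Lemma totient_le_pow2 (n a : nat) : (0 < a)%N -> (totient a <= totient (2 ^ n * a))%N.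
Proof.
move=> a0; elim: n => [|n IH]; first by rewrite mul1n.
rewrite expnS -mulnA; apply: (leq_trans IH); apply: totient_le_double.
by rewrite muln_gt0 expn_gt0.
Qed.

Section CoprimesIn.
Variable R : realType.
Implicit Types u v : R.

Definition coprimes_in (M : nat) u v : seq nat :=
  [seq b <- iota 0 (Num.truncn v).+1 | (u <= b%:R) && coprime M b].

Lemma mem_coprimes_in M u v b : 0 <= v ->
  (b \in coprimes_in M u v) = [&& u <= b%:R, b%:R <= v & coprime M b].
Proof.
move=> v0; rewrite mem_filter mem_iota /= add0n ltnS truncn_ge_nat //.
by rewrite -andbA; congr (_ && _); rewrite andbC.
Qed.

Lemma coprimes_in_uniq M u v : uniq (coprimes_in M u v).
Proof. exact/filter_uniq/iota_uniq. Qed.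

(** The interval contains at least [(v - u) / M - 1] disjoint blocks of [M]
    consecutive integers, and each block has [totient M] members coprime to
    [M]. *)
Lemma size_coprimes_in M u v : (0 < M)%N -> 0 <= u -> 2 * M%:R <= v - u ->
  (totient M)%:R * ((v - u) / (2 * M%:R)) <= (size (coprimes_in M u v))%:R.
Proof.
move=> M0 u0 uv; have M0r : 0 < M%:R :> R by rewrite ltr0n.
have v0 : 0 <= v by lra.
have w0 : 0 <= (v - u) / M%:R by rewrite divr_ge0 //; lra.
pose B := (Num.truncn u).+1; pose k := Num.truncn ((v - u) / M%:R).
have /andP[u1 u2] := truncn_itv u0.
have /andP[k1 k2] := truncn_itv w0.
have kM : k%:R * M%:R <= v - u by rewrite -ler_pdivlMr.
have kge : (v - u) / (2 * M%:R) <= k%:R.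
  have w2 : 2 <= (v - u) / M%:R by rewrite ler_pdivlMr.
  have -> : (v - u) / (2 * M%:R) = (v - u) / M%:R / 2 by field; lra.
  move: k2; rewrite -natr1 -/k; lra.
apply: (@le_trans _ _ (k * totient M)%:R).
  by rewrite natrM mulrC ler_wpM2r.
rewrite ler_nat -(count_coprime_blocks _ B) -size_filter.
apply: uniq_leq_size; first exact/filter_uniq/iota_uniq.
move=> b; rewrite mem_filter mem_iota => /and3P[cb Bb bB].
rewrite mem_coprimes_in // cb andbT; apply/andP; split.
  by apply: (le_trans (ltW u2)); rewrite ler_nat.
have : b%:R + 1 <= (B + k * M)%:R :> R by rewrite natr1 ler_nat.
rewrite natrD natrM /B -natr1; lra.
Qed.
End CoprimesIn.

(** * Integer points on rational sections *)

Section Points.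
Variable R : realType.

(** The ring is a parameter because the same form is used on integer points and
    on real vectors. *)
Definition diag_form (K : comNzRingType) (j : nat) (v : 'cV[K]_(j + 2 + 1)) : K :=
  \sum_(i < j) v (lshift 1 (lshift 2 i)) 0 ^+ 2
  - \sum_(i < 2) v (lshift 1 (rshift j i)) 0 ^+ 2 - v (rshift (j + 2) 0) 0 ^+ 2.

Definition isotropic_coord (K : comNzRingType) (j' : nat)
    (v : 'cV[K]_(j'.+1 + 2 + 1)) : K :=
  v (lshift 1 (rshift j'.+1 0)) 0 - v (lshift 1 (lshift 2 0)) 0.

Definition last_coord (K : comNzRingType) (m : nat) (v : 'cV[K]_(m + 1)) : K :=
  v (rshift m 0) 0.

Definition col_of_seq (m : nat) (s : seq int) : 'cV[int]_m := \col_i s`_i.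

Lemma col_of_seqE m s (i : 'I_m) : col_of_seq m s i 0 = s`_i.
Proof. by rewrite mxE. Qed.

Lemma col_of_seq_nth m s s' k : (k < m)%N ->
  col_of_seq m s = col_of_seq m s' -> s`_k = s'`_k.
Proof.
by move=> km e; rewrite -[k]/(val (Ordinal km)) -!col_of_seqE e.
Qed.

Definition coprime_pairs (M G : nat) (u v : R) : seq (nat * nat) :=
  [seq (a, b) | a <- iota 1 G, b <- coprimes_in (M * a) (u / a%:R) (v / a%:R)].

Lemma coprime_pairs_uniq M G u v : uniq (coprime_pairs M G u v).
Proof.
apply: allpairs_uniq_dep; first exact: iota_uniq.
  by move=> a _; apply: coprimes_in_uniq.
by move=> [a b] [c d] _ _ [-> ->].
Qed.

Lemma mem_coprime_pairs M G u v a b : 0 <= v -> (a, b) \in coprime_pairs M G u v ->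
  [/\ (0 < a)%N, u <= (a * b)%:R, (a * b)%:R <= v & coprime (M * a) b].
Proof.
move=> v0 /allpairsPdep[a' [b' [aG bc [ea eb]]]].
move: aG bc; rewrite -ea -eb mem_iota => /andP[a0 _] {ea eb a' b'}.
have ar : 0 < a%:R :> R by rewrite ltr0n.
rewrite mem_coprimes_in ?divr_ge0 // => /and3P[ub bv cb]; split => //.
  by rewrite natrM mulrC -ler_pdivrMr.
by rewrite natrM mulrC -ler_pdivlMr.
Qed.

(** For each [a] there are about [totient (M a) / (M a) * (v - u) / a] values of
    [b], hence the totient sum. *)
Lemma size_coprime_pairs n G u v : 0 <= u -> 2 * 2 ^+ n * G%:R ^+ 2 <= v - u ->
  (v - u) / (2 * 2 ^+ n) * \sum_(1 <= a < G.+1) (totient a)%:R / a%:R ^+ 2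
  <= (size (coprime_pairs (2 ^ n) G u v))%:R.
Proof.
move=> u0 uv; rewrite size_allpairs_dep sumnE big_map natr_sum /index_iota subn1.
rewrite mulr_sumr !big_seq; apply: ler_sum => a.
rewrite mem_iota add1n ltnS => /andP[a0 aG].
have vu : 0 <= v - u by apply: le_trans _ uv; rewrite !mulr_ge0 ?exprn_ge0.
have q0 : 0 < 2 ^+ n :> R by rewrite exprn_gt0.
have ar : 0 < a%:R :> R by rewrite ltr0n.
have aGr : a%:R <= G%:R :> R by rewrite ler_nat.
have M0 : (0 < 2 ^ n * a)%N by rewrite muln_gt0 expn_gt0.
apply: (le_trans _ (size_coprimes_in M0 _ _)).
- apply: (@le_trans _ _ ((totient a)%:R * ((v / a%:R - u / a%:R) / (2 * (2 ^ n * a)%:R)))).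
    rewrite natrM natrX le_eqVlt; apply/orP; left; apply/eqP; field.
    by rewrite !gt_eqF.
  rewrite ler_wpM2r ?ler_nat ?totient_le_pow2 // -mulrBl.
  by rewrite !divr_ge0 ?mulr_ge0 ?ler0n.
- by rewrite divr_ge0.
rewrite -mulrBl ler_pdivlMr // natrM natrX; apply: le_trans _ uv.
have -> : 2 * (2 ^+ n * a%:R) * a%:R = 2 * 2 ^+ n * a%:R ^+ 2 :> R by ring.
rewrite ler_pM2l ?mulr_gt0 //.
by rewrite lerXn2r ?nnegrE.
Qed.


(** With [alpha = p / q], the second condition says that the point lies on the
    rational hyperplane [w = alpha * X]. *)
Definition good_point (j' : nat) (p q : nat) (e : int) (lo hi B : R)
    (v : 'cV[int]_(j'.+1 + 2 + 1)) : Prop :=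
  [/\ diag_form v = e,
      last_coord v * q%:Z = isotropic_coord v * p%:Z,
      lo <= (isotropic_coord v)%:~R <= hi &
      forall i, `|(v i 0)%:~R| <= B].

(** For coprime [a] and [b], the Bezout identity [m b = q^2 a k + 1] solves
    [t y' = z' (q^2 z' + 1)] by [t = a b], [z' = a k] and [y' = k m].  The
    coordinates are then read off from [X = 2 x], [v_0 + v_1 = 2 y],
    [z = 2 q^2 z' + 1] and [w = (p / q) X]. *)
Definition point1 (p q : nat) (c : nat * nat) : 'cV[int]_(1 + 2 + 1) :=
  let: (a, b) := c in
  let: (m, k) := egcdn b (q ^ 2 * a) in
  let x := (q ^ 2 * (a * b))%:Z in
  let y := - ((k * m)%:Z + (p ^ 2 * (a * b))%:Z) in
  col_of_seq _ [:: y - x; x + y; (2 * q ^ 2 * (a * k)).+1%:Z; (2 * p * q * (a * b))%:Z].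

Lemma egcdn_coprime_spec (a b q : nat) : (0 < b)%N -> coprime (q * a) b ->
  let: (m, k) := egcdn b (q ^ 2 * a) in (m * b = q ^ 2 * a * k + 1)%N /\ (k < b)%N.
Proof.
move=> b0 ab; have /eqP g1 : coprime b (q ^ 2 * a).
  by move: ab; rewrite coprime_sym coprimeMr => /andP[qb ab]; rewrite coprimeMr ab coprimeXr.
case: egcdnP => // m k; rewrite g1 => mb kb; split; last by rewrite muln1 in kb.
by rewrite mb mulnC.
Qed.

Lemma diag_form1 s : diag_form (col_of_seq (1 + 2 + 1) s)
  = s`_0 ^+ 2 - (s`_1 ^+ 2 + s`_2 ^+ 2) - s`_3 ^+ 2.
Proof. by rewrite /diag_form !big_ord_recl !big_ord0 !mxE /= !addr0. Qed.

(** The identity behind the first condition is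
    [4 q^2 t y' + 1 = (2 q^2 z' + 1)^2]; the bounds follow from [k < b]. *)
Lemma good_point1 p q (lo hi : R) a b : (p <= q)%N -> (0 < q)%N ->
  (0 < a)%N -> (0 < b)%N -> coprime (q * a) b ->
  lo <= 2 * q%:R ^+ 2 * (a * b)%:R <= hi ->
  good_point p q (-1) lo hi (2 * hi) (point1 p q (a, b)).
Proof.
move=> pq q0 a0 b0 cab lohi; rewrite /good_point /point1.
have := egcdn_coprime_spec b0 cab; case: egcdn => m k [mb kb].
split.
- rewrite diag_form1 /=.
  have mbZ : (m : int) * b = q%:Z ^+ 2 * a * k + 1 by lia.
  have -> : (2 * q ^ 2 * (a * k)).+1%:Z = 2 * q%:Z ^+ 2 * a * k + 1 by lia.
  have -> : (q ^ 2 * (a * b))%:Z = q%:Z ^+ 2 * a * b by lia.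
  have -> : (k * m)%:Z + (p ^ 2 * (a * b))%:Z = k%:Z * m + p%:Z ^+ 2 * a * b by lia.
  have -> : (2 * p * q * (a * b))%:Z = 2 * p%:Z * q * a * b by lia.
  transitivity (4 * q%:Z ^+ 2 * a * k * (m%:Z * b) - (2 * q%:Z ^+ 2 * a * k + 1) ^+ 2 : int).
    by ring.
  by rewrite mbZ; ring.
- rewrite /last_coord /isotropic_coord !col_of_seqE /=; lia.
- rewrite /isotropic_coord !col_of_seqE /=.
  set x := (q ^ 2 * (a * b))%:Z; set y := - _.
  have -> : x + y - (y - x) = (2 * q ^ 2 * (a * b))%:Z by rewrite /x; lia.
  rewrite -pmulrn.
  have -> // : (2 * q ^ 2 * (a * b))%:R = 2 * q%:R ^+ 2 * (a * b)%:R :> R.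
  by rewrite !natrM; ring.
have kmN : (k * m <= q ^ 2 * (a * b))%N.
  have h : (k * m * b <= k * (q ^ 2 * a * b))%N.
    rewrite -mulnA leq_mul2l mb; apply/orP; right.
    rewrite addn1; apply: (@leq_trans (q ^ 2 * a * k.+1)); last by rewrite leq_mul2l kb orbT.
    by rewrite mulnS -addn1 addnC leq_add2r muln_gt0 expn_gt0 q0.
  have : (k * m * b <= k * (q ^ 2 * a) * b)%N by rewrite -(mulnA k (_ * _)%N).
  rewrite leq_pmul2r // => /leq_trans; apply.
  by rewrite mulnC mulnA leq_mul2l (ltnW kb) orbT.
have pN : (p ^ 2 * (a * b) <= q ^ 2 * (a * b))%N by rewrite leq_mul2r leq_exp2r // pq orbT.
have zN : ((2 * q ^ 2 * (a * k)).+1 <= 2 * (q ^ 2 * (a * b)))%N.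
  by rewrite -mulnA ltn_pmul2l // !ltn_pmul2l // expn_gt0 q0.
have wN : (2 * p * q * (a * b) <= 2 * (q ^ 2 * (a * b)))%N.
  by rewrite [leqRHS]mulnA leq_mul2r -mulnA leq_mul2l -mulnn leq_mul2r pq !orbT.
move=> i; rewrite -intr_norm -abszE -pmulrn.
apply: (@le_trans _ _ (4 * (q ^ 2 * (a * b)))%:R); first rewrite ler_nat col_of_seqE.
  by case: i => -[|[|[|[|i]]]] //= _; lia.
  have -> : (4 * (q ^ 2 * (a * b)))%:R = 2 * (2 * q%:R ^+ 2 * (a * b)%:R) :> R.
    by rewrite !natrM; ring.
  by rewrite ler_pM2l //; case/andP: lohi.
Qed.

End Points.

Section ManyPoints.
Variable R : realType.

(** The point determines [a b] and [a k], and the Bezout identity makes [b] and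
    [k] coprime, so that [a] is their gcd. *)
Lemma point1_inj p q a b a' b' : (0 < q)%N ->
  (0 < a)%N -> (0 < b)%N -> coprime (q * a) b ->
  (0 < a')%N -> (0 < b')%N -> coprime (q * a') b' ->
  point1 p q (a, b) = point1 p q (a', b') -> (a, b) = (a', b').
Proof.
move=> q0 a0 b0 ab a'0 b'0 ab'; rewrite /point1.
have := egcdn_coprime_spec b0 ab; have := egcdn_coprime_spec b'0 ab'.
case: (egcdn b' _) => m' k' [mb' _]; case: (egcdn b _) => m k [mb _] e.
have q20 : (0 < q ^ 2)%N by rewrite expn_gt0 q0.
have e0 := @col_of_seq_nth 4 _ _ 0 isT e; have e1 := @col_of_seq_nth 4 _ _ 1 isT e.
have e2 := @col_of_seq_nth 4 _ _ 2 isT e; rewrite /= in e0 e1 e2.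
have {}e0 : (q ^ 2 * (a * b) = q ^ 2 * (a' * b'))%N by lia.
have {}e2 : (q ^ 2 * (a * k) = q ^ 2 * (a' * k'))%N by lia.
move/eqP: e0; rewrite eqn_pmul2l // => /eqP e0.
move/eqP: e2; rewrite eqn_pmul2l // => /eqP e2.
have gcd_a c d l n : (n * d = q ^ 2 * c * l + 1)%N -> gcdn (c * d) (c * l) = c.
  move=> nd; rewrite -muln_gcdr; suff -> : gcdn d l = 1%N by rewrite muln1.
  apply/eqP; rewrite -dvdn1 -(@dvdn_addr (q ^ 2 * c * l)).
    by rewrite -nd dvdn_mull // dvdn_gcdl.
  by rewrite dvdn_mull // dvdn_gcdr.
have ea : a = a' by rewrite -(gcd_a _ _ _ _ mb) e0 e2 (gcd_a _ _ _ _ mb').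
move/eqP: e0; rewrite ea eqn_pmul2l // => /eqP ->.
by [].
Qed.

Lemma sqr_le_of_pow4_le (c Y : R) (G : nat) : 0 < c -> G%:R ^+ 4 <= Y ->
  1 <= Y -> c ^- 2 <= Y -> G%:R ^+ 2 <= c * Y.
Proof.
move=> c0 GY Y1 cY; have cY0 : 0 <= c * Y by rewrite mulr_ge0 //; lra.
rewrite -ler_sqr ?nnegrE ?exprn_ge0 // -exprM.
apply: (le_trans GY); rewrite exprMn.
have : 1 <= c ^+ 2 * Y by rewrite -ler_pdivrMl ?exprn_gt0 // mulr1.
have Y0 : 0 <= Y by lra.
by move=> /(ler_wpM2r Y0); rewrite mul1r expr2 mulrA.
Qed.

(** The constants may depend on the denominator [2 ^ n] but not on the numerator
    [p]: the Liouville number is only fixed after they are known. *)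
Lemma many_points1 (n : nat) (b1 b2 : R) : 0 < b1 -> b1 < b2 ->
  exists kappa K Y0 : R, [/\ 0 < kappa, 0 < K, 1 <= Y0 &
    forall (p : nat) (Y : R), (p <= 2 ^ n)%N -> Y0 <= Y ->
    exists s : seq 'cV[int]_(1 + 2 + 1), [/\ uniq s,
      kappa * (Y ^+ 1 * ln Y) <= (size s)%:R &
      forall v, v \in s ->
        good_point p (2 ^ n) (-1) (b1 * Y) (b2 * Y) (K * Y) v]].
Proof.
move=> b10 b12; pose q : R := 2 ^+ n; have q0 : 0 < q by rewrite exprn_gt0.
have b0 : 0 < b2 - b1 by lra.
pose c := (b2 - b1) / (4 * q ^+ 3).
have c0 : 0 < c by rewrite divr_gt0 ?mulr_gt0 ?exprn_gt0.
exists (c / 8), (2 * b2), (Num.max 1 (c ^- 2)); split; try by lra.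
  by rewrite le_max lexx.
move=> p Y pq; rewrite ge_max => /andP[Y1 cY].
have [G [G0 [GY lnG]]] := totient_sum_ge_ln Y1.
have G2 := sqr_le_of_pow4_le c0 GY Y1 cY.
have Y0 : 0 < Y by lra.
pose u := b1 * Y / (2 * q ^+ 2); pose v := b2 * Y / (2 * q ^+ 2).
have u0 : 0 < u by rewrite divr_gt0 ?mulr_gt0 ?exprn_gt0.
have v0 : 0 < v by rewrite divr_gt0 ?mulr_gt0 ?exprn_gt0 //; lra.
have uvE : v - u = 2 * q * c * Y by rewrite /u /v /c; field; lra.
pose P := coprime_pairs (2 ^ n) G u v.
have Pok a b : (a, b) \in P -> [/\ (0 < a)%N, (0 < b)%N, coprime (2 ^ n * a) b &
    b1 * Y <= 2 * (2 ^ n)%:R ^+ 2 * (a * b)%:R <= b2 * Y].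
  move=> /(mem_coprime_pairs (ltW v0))[a0 uab abv cab]; split => //.
    rewrite lt0n; apply/eqP => b_0; move: uab; rewrite b_0 muln0; lra.
  have q20 : 0 < 2 * q ^+ 2 by rewrite mulr_gt0 ?exprn_gt0.
  by rewrite natrX -/q -ler_pdivrMl // mulrC uab /= -ler_pdivlMl // mulrC.
exists (map (point1 p (2 ^ n)) P); split.
- rewrite map_inj_in_uniq ?coprime_pairs_uniq // => -[a b] [a' b'].
  by move=> /Pok[? ? ? _] /Pok[? ? ? _]; apply: point1_inj => //; rewrite expn_gt0.
- have GcY : 2 * 2 ^+ n * G%:R ^+ 2 <= v - u.
    by rewrite -/q uvE -[leRHS]mulrA ler_pM2l // mulr_gt0.
  have := size_coprime_pairs (ltW u0) GcY; rewrite -/q uvE -/P => sP.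
  rewrite size_map expr1; apply: le_trans sP.
  apply: (@le_trans _ _ (c * Y * (ln Y / 8))); first by lra.
  have -> : 2 * q * c * Y / (2 * q) = c * Y by field; lra.
  by rewrite ler_pM2l // mulr_gt0.
move=> w /mapP[[a b] /Pok[a0 b_0 cab ab] ->].
have := good_point1 pq _ a0 b_0 cab ab; rewrite expn_gt0 mulrA; exact.
Qed.

(** The solutions of [t' y' = z' u'] with [t' > 0] are parametrized by the reduced
    fraction [r / g = u' / t' = y' / z'], the tuples [(g, (r, (t, z)))] standing
    for [t' = g t], [z' = g z], [u' = r t], [y' = r z].  For given [g] there are
    [totient g] numerators [r < g]. *)
Definition quads (G : nat) (u v Y : R) : seq (nat * (nat * (nat * nat))) :=
  [seq (g, x) | g <- iota 1 G,
     x <- [seq (r, tz) | r <- [seq r <- iota 0 g | coprime g r],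
             tz <- [seq (t, z) | t <- coprimes_in 1 (u / g%:R) (v / g%:R),
                                 z <- coprimes_in 1 0 (Y / g%:R)]]].

Lemma quads_uniq G u v Y : uniq (quads G u v Y).
Proof.
apply: allpairs_uniq_dep; first exact: iota_uniq; last by move=> [a b] [c d] _ _ [-> ->].
move=> g _; apply: allpairs_uniq; last by move=> [a b] [c d] _ _ [-> ->].
  exact/filter_uniq/iota_uniq.
apply: allpairs_uniq; try exact: coprimes_in_uniq.
by move=> [a b] [c d] _ _ [-> ->].
Qed.

Lemma mem_quads G u v Y g r t z : 0 <= v -> 0 <= Y ->
  (g, (r, (t, z))) \in quads G u v Y ->
  [/\ (0 < g)%N /\ coprime g r, (r < g)%N, u <= (g * t)%:R <= v & (g * z)%:R <= Y].
Proof.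
move=> v0 Y0 /allpairsPdep[g' [x [gG xs [eg ex]]]].
move: gG xs; rewrite -eg -ex mem_iota => /andP[g0 _] {eg ex g' x}.
have gr : 0 < g%:R :> R by rewrite ltr0n.
move=> /allpairsP[[r' tz] [rs tzs [er etz]]]; move: rs tzs; rewrite /= -er -etz.
rewrite mem_filter mem_iota => /andP[gr1 rg] /allpairsP[[t' z'] [ts zs [et ez]]].
move: ts zs; rewrite /= -et -ez !mem_coprimes_in ?divr_ge0 //.
move=> /and3P[ut tv _] /and3P[_ zY _]; split => //.
  by rewrite natrM mulrC -ler_pdivrMr // ut -ler_pdivlMr.
by rewrite natrM mulrC -ler_pdivlMr.
Qed.

Lemma size_quads G u v Y : 0 <= u -> 2 * G%:R ^+ 2 <= v - u -> 2 * G%:R ^+ 2 <= Y ->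
  (v - u) * Y / 4 * \sum_(1 <= a < G.+1) (totient a)%:R / a%:R ^+ 2
  <= (size (quads G u v Y))%:R.
Proof.
move=> u0 uv GY; rewrite size_allpairs_dep sumnE big_map natr_sum /index_iota subn1.
rewrite mulr_sumr !big_seq; apply: ler_sum => g.
rewrite mem_iota add1n ltnS => /andP[g0 gG].
have gr : 0 < g%:R :> R by rewrite ltr0n.
have g1 : 1 <= g%:R :> R by rewrite (ler_nat _ 1).
have gG2 : g%:R ^+ 2 <= G%:R ^+ 2 :> R by rewrite lerXn2r ?nnegrE // ler_nat.
have gg : g%:R <= g%:R ^+ 2 :> R by rewrite expr2 ler_peMr // ltW.
rewrite !size_allpairs size_filter -totient_count natrM natrM.
have G20 : 0 <= G%:R ^+ 2 :> R by rewrite exprn_ge0.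
have count1 u' v' : 0 <= u' -> 2 * G%:R ^+ 2 <= v' - u' ->
    (v' - u') / (2 * g%:R) <= (size (coprimes_in 1 (u' / g%:R) (v' / g%:R)))%:R :> R.
  move=> u'0 uv'; apply: le_trans _ (size_coprimes_in (M := 1) isT _ _).
  - by rewrite totientE // big_nil mul1r mulr1 -mulrBl -mulrA -invfM [g%:R * 2]mulrC.
  - by rewrite divr_ge0 // ltW.
  by rewrite -mulrBl mulr1 ler_pdivlMr //; lra.
have Y0 : 0 <= Y by lra.
have h1 := count1 u v u0 uv; have := count1 0 Y (lexx _); rewrite subr0 mul0r => /(_ GY) h2.
apply: (@le_trans _ _ ((totient g)%:R * (((v - u) / (2 * g%:R)) * (Y / (2 * g%:R))))).
  by rewrite le_eqVlt; apply/orP; left; apply/eqP; field; lra.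
rewrite ler_wpM2l //; apply: ler_pM => //; rewrite divr_ge0 ?mulr_ge0 //; lra.
Qed.

(** Here [X = 2 x], [v_0 + v_2 = 2 y], [v_1 - v_3 = 2 x'], [v_1 + v_3 = 2 y'] and
    [w = (p / q) X] turn the equation [t' y' = z' u'] into an isotropic vector. *)
Definition point2 (p q : nat) (c : nat * (nat * (nat * nat))) : 'cV[int]_(2 + 2 + 1) :=
  let: (g, (r, (t, z))) := c in
  let x := (q ^ 2 * (g * t))%:Z in
  let y := (r * z)%:Z - (p ^ 2 * (g * t))%:Z in
  let x' := (q ^ 2 * (g * z))%:Z in
  let y' := (r * t)%:Z in
  col_of_seq _ [:: y - x; y' + x'; x + y; y' - x'; (2 * p * q * (g * t))%:Z].

Lemma diag_form2 s : diag_form (col_of_seq (2 + 2 + 1) s)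
  = s`_0 ^+ 2 + s`_1 ^+ 2 - (s`_2 ^+ 2 + s`_3 ^+ 2) - s`_4 ^+ 2.
Proof. by rewrite /diag_form !big_ord_recl !big_ord0 !mxE /= !addr0. Qed.

Lemma good_point2 p q (lo hi Y : R) g r t z : (p <= q)%N -> (0 < q)%N ->
  (r < g)%N -> lo <= 2 * q%:R ^+ 2 * (g * t)%:R <= hi -> (g * z)%:R <= Y ->
  good_point p q 0 lo hi (hi + q%:R ^+ 2 * Y) (point2 p q (g, (r, (t, z)))).
Proof.
move=> pq q0 rg lohi zY; rewrite /good_point /point2.
have eX : (2 * q ^ 2 * (g * t))%:R = 2 * q%:R ^+ 2 * (g * t)%:R :> R.
  by rewrite !natrM; ring.
split.
- rewrite diag_form2 /=.
  have -> : (q ^ 2 * (g * t))%:Z = q%:Z ^+ 2 * g * t by lia.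
  have -> : (q ^ 2 * (g * z))%:Z = q%:Z ^+ 2 * g * z by lia.
  have -> : (p ^ 2 * (g * t))%:Z = p%:Z ^+ 2 * g * t by lia.
  have -> : (2 * p * q * (g * t))%:Z = 2 * p%:Z * q * g * t by lia.
  by rewrite !PoszM; ring.
- rewrite /last_coord /isotropic_coord !col_of_seqE /=; lia.
- rewrite /isotropic_coord !col_of_seqE /=.
  set x := (q ^ 2 * (g * t))%:Z; set y := (r * z)%:Z - _.
  have -> : x + y - (y - x) = (2 * q ^ 2 * (g * t))%:Z by rewrite /x; lia.
  by rewrite -pmulrn eX.
have q20 : (0 < q ^ 2)%N by rewrite expn_gt0 q0.
have pN : (p ^ 2 * (g * t) <= q ^ 2 * (g * t))%N by rewrite leq_mul2r leq_exp2r // pq orbT.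
have rz : (r * z <= g * z)%N by rewrite leq_mul2r (ltnW rg) orbT.
have rt : (r * t <= g * t)%N by rewrite leq_mul2r (ltnW rg) orbT.
have gtq : (g * t <= q ^ 2 * (g * t))%N by rewrite leq_pmull.
have gzq : (g * z <= q ^ 2 * (g * z))%N by rewrite leq_pmull.
have wN : (2 * p * q * (g * t) <= 2 * (q ^ 2 * (g * t)))%N.
  by rewrite [leqRHS]mulnA leq_mul2r -mulnA leq_mul2l -mulnn leq_mul2r pq !orbT.
move=> i; rewrite -intr_norm -abszE -pmulrn.
apply: (@le_trans _ _ (2 * (q ^ 2 * (g * t)) + q ^ 2 * (g * z))%:R).
  by rewrite ler_nat col_of_seqE; case: i => -[|[|[|[|[|i]]]]] //= _; lia.
rewrite natrD lerD //.
  by rewrite mulnA eX; case/andP: lohi.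
by rewrite natrM natrX ler_pM2l // exprn_gt0 // ltr0n.
Qed.

(** The common factor [t] is the gcd of [g t] and [r t], both visible in the
    point. *)
Lemma point2_inj p q g r t z g' r' t' z' : (0 < q)%N ->
  (0 < g)%N -> coprime g r -> (0 < t)%N -> (0 < g')%N -> coprime g' r' -> (0 < t')%N ->
  point2 p q (g, (r, (t, z))) = point2 p q (g', (r', (t', z'))) ->
  (g, (r, (t, z))) = (g', (r', (t', z'))).
Proof.
move=> q0 g0 gr t0 g'0 gr' t'0 e.
have q20 : (0 < q ^ 2)%N by rewrite expn_gt0 q0.
have e0 := @col_of_seq_nth 5 _ _ 0 isT e; have e1 := @col_of_seq_nth 5 _ _ 1 isT e.
have e2 := @col_of_seq_nth 5 _ _ 2 isT e; have e3 := @col_of_seq_nth 5 _ _ 3 isT e.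
rewrite /= in e0 e1 e2 e3.
have {}e0 : (q ^ 2 * (g * t) = q ^ 2 * (g' * t'))%N by lia.
have {}e2 : (q ^ 2 * (g * z) = q ^ 2 * (g' * z'))%N by lia.
have {}e3 : (r * t = r' * t')%N by lia.
move/eqP: e0; rewrite eqn_pmul2l // => /eqP e0.
move/eqP: e2; rewrite eqn_pmul2l // => /eqP e2.
have et : t = t'.
  have h a b c : coprime a b -> gcdn (a * c) (b * c) = c.
    by move=> /eqP ab; rewrite -muln_gcdl ab mul1n.
  by rewrite -(h _ _ t gr) e0 e3 (h _ _ _ gr').
move/eqP: e0; rewrite -et eqn_pmul2r // => /eqP eg.
move/eqP: e3; rewrite -et eqn_pmul2r // => /eqP er.
by move/eqP: e2; rewrite -eg eqn_pmul2l // => /eqP ez; rewrite er ez.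
Qed.

Lemma many_points2 (n : nat) (b1 b2 : R) : 0 < b1 -> b1 < b2 ->
  exists kappa K Y0 : R, [/\ 0 < kappa, 0 < K, 1 <= Y0 &
    forall (p : nat) (Y : R), (p <= 2 ^ n)%N -> Y0 <= Y ->
    exists s : seq 'cV[int]_(2 + 2 + 1), [/\ uniq s,
      kappa * (Y ^+ 2 * ln Y) <= (size s)%:R &
      forall v, v \in s ->
        good_point p (2 ^ n) 0 (b1 * Y) (b2 * Y) (K * Y) v]].
Proof.
move=> b10 b12; pose q : R := 2 ^+ n; have q0 : 0 < q by rewrite exprn_gt0.
have q20 : 0 < q ^+ 2 by rewrite exprn_gt0.
have b0 : 0 < b2 - b1 by lra.
pose l := (b2 - b1) / (2 * q ^+ 2).
have l0 : 0 < l by rewrite divr_gt0 ?mulr_gt0.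
pose c := Num.min (l / 2) (1 / 2).
have c0 : 0 < c by rewrite lt_min; apply/andP; split; lra.
exists (l / 32), (b2 + q ^+ 2), (Num.max 1 (c ^- 2)); split; try by lra.
  by rewrite le_max lexx.
move=> p Y pq; rewrite ge_max => /andP[Y1 cY].
have [G [G0 [GY lnG]]] := totient_sum_ge_ln Y1.
have G2 := sqr_le_of_pow4_le c0 GY Y1 cY.
have Y0 : 0 < Y by lra.
have cl : c * Y <= l / 2 * Y by rewrite ler_pM2r // ge_min lexx.
have c2 : c * Y <= 1 / 2 * Y by rewrite ler_pM2r // ge_min lexx orbT.
pose u := b1 * Y / (2 * q ^+ 2); pose v := b2 * Y / (2 * q ^+ 2).
have u0 : 0 < u by rewrite divr_gt0 ?mulr_gt0.
have v0 : 0 < v by rewrite divr_gt0 ?mulr_gt0 //; lra.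
have uvE : v - u = l * Y by rewrite /u /v /l; field; lra.
pose P := quads G u v Y.
have Pok g r t z : (g, (r, (t, z))) \in P ->
    [/\ (0 < g)%N /\ coprime g r, (0 < t)%N, (r < g)%N,
    b1 * Y <= 2 * (2 ^ n)%:R ^+ 2 * (g * t)%:R <= b2 * Y & (g * z)%:R <= Y].
  move=> /(mem_quads (ltW v0) (ltW Y0))[g0 rg /andP[ut tv] zY]; split => //.
    rewrite lt0n; apply/eqP => t_0; move: ut; rewrite t_0 muln0; lra.
  have q220 : 0 < 2 * q ^+ 2 by rewrite mulr_gt0.
  by rewrite natrX -/q -ler_pdivrMl // mulrC ut /= -ler_pdivlMl // mulrC.
exists (map (point2 p (2 ^ n)) P); split.
- rewrite map_inj_in_uniq ?quads_uniq // => -[g [r [t z]]] [g' [r' [t' z']]].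
  move=> /Pok[[? ?] ? _ _ _] /Pok[[? ?] ? _ _ _]; apply: point2_inj => //.
  by rewrite expn_gt0.
- have Guv : 2 * G%:R ^+ 2 <= v - u by rewrite uvE; lra.
  have GY2 : 2 * G%:R ^+ 2 <= Y by lra.
  have := size_quads (ltW u0) Guv GY2; rewrite uvE -/P => sP.
  rewrite size_map; apply: le_trans sP.
  apply: (@le_trans _ _ (l * Y * Y / 4 * (ln Y / 8))); first by lra.
  by rewrite ler_pM2l // divr_gt0 // (mulr_gt0 (mulr_gt0 l0 Y0) Y0).
move=> w /mapP[[g [r [t z]]] /Pok[[g0 gr] t0 rg ab gz] ->].
rewrite mulrDl /q -natrX; apply: good_point2 => //.
by rewrite expn_gt0.
Qed.
End ManyPoints.

(** * Growth comparison and Liouville numbers *)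

Section Analysis.
Variable R : realType.

(** Since [ln (K Y) <= 2 ln Y] for [Y >= K], it is enough that [(ln Y) ^ eps]
    exceed a constant [C], which holds once [ln Y >= C ^ (1 / eps)]. *)
Lemma powR_ln_lt (j : nat) (eps kappa K : R) : 0 < eps -> 0 < kappa -> 1 <= K ->
  exists Y0 : R, forall Y, Y0 <= Y ->
    (K * Y) ^+ j * (ln (K * Y) `^ (1 - eps)) < kappa * (Y ^+ j * ln Y).
Proof.
move=> e0 k0 K1; have K0 : 0 < K by lra.
pose C := 2 * K ^+ j / kappa + 1.
have Kj0 : 0 < K ^+ j by rewrite exprn_gt0.
have C0 : 1 < C by rewrite /C ltrDr divr_gt0 ?mulr_gt0.
pose M := C `^ eps^-1.
exists (Num.max K (expR (Num.max 1 M))) => Y; rewrite ge_max => /andP[KY MY].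
have Y0 : 0 < Y by lra.
have : Num.max 1 M <= ln Y by rewrite -ler_expR lnK ?posrE.
rewrite ge_max => /andP[Y1 MlY].
have lKY : ln (K * Y) = ln K + ln Y by rewrite lnM ?posrE.
have lnK_le : ln K <= ln Y by rewrite ler_ln ?posrE.
have lnK0 : 0 <= ln K by rewrite ln_ge0.
move: (ln (K * Y)) lKY => L lKY.
have L0 : 0 < L by lra.
have -> : L `^ (1 - eps) = L / L `^ eps.
  have Ln0 : L != 0 by rewrite gt_eqF.
  by rewrite powRD ?Ln0 ?implybT // powRN powRr1 // ltW.
have CL : C <= L `^ eps.
  have -> : C = M `^ eps by rewrite /M -powRrM mulVf ?gt_eqF // powRr1; lra.
  by rewrite ge0_ler_powR ?nnegrE ?powR_ge0 //; lra.
have Le0 : 0 < L `^ eps by lra.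
have Yj0 : 0 < Y ^+ j by rewrite exprn_gt0.
have KC : 2 * K ^+ j < kappa * C.
  by rewrite /C mulrDr mulrCA mulfV ?gt_eqF // !mulr1 ltrDl.
rewrite mulrA ltr_pdivrMr // exprMn.
apply: (@le_lt_trans _ _ (Y ^+ j * ln Y * (2 * K ^+ j))).
  have -> : Y ^+ j * ln Y * (2 * K ^+ j) = K ^+ j * Y ^+ j * (2 * ln Y) by ring.
  by rewrite ler_pM2l ?mulr_gt0 //; lra.
apply: (@lt_le_trans _ _ (Y ^+ j * ln Y * (kappa * C))).
  by rewrite ltr_pM2l // mulr_gt0 //; lra.
rewrite mulrA [X in X * C]mulrC ler_pM2l // !mulr_gt0 //; lra.
Qed.

(** A sum of reciprocals of powers of 2 whose exponents [n_i] grow so fast that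
    the tail after [2 ^ - n_i] is below [f n_i] and below [4 ^ - n_i]; the second
    bound makes the limit irrational.  The partial sums have the form
    [p_i / 2 ^ n_i], and the limit is their supremum. *)
Lemma liouville_exists (f : nat -> R) : (forall n, 0 < f n) ->
  exists alpha : R, ~ rational alpha /\
    forall N, exists n p : nat, [/\ (N <= n)%N, (p <= 2 ^ n)%N &
      0 < alpha - p%:R / 2 ^+ n < f n].
Proof.
move=> f0; pose h n := Num.min (f n) (4 ^+ n)^-1.
have h0 n : 0 < h n by rewrite lt_min f0 invr_gt0 exprn_gt0.
have pow2_gt n : n%:R < 2 ^+ n :> R by rewrite -natrX ltr_nat ltn_expl.
have pow2_0 n : 0 < 2 ^+ n :> R by rewrite exprn_gt0.
have /choice[g gP] n : exists m, (n < m)%N /\ 2 / 2 ^+ m < h n.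
  pose m := maxn n.+1 (Num.truncn (2 / h n)).+1; exists m.
  split; first by rewrite leq_max ltnSn.
  rewrite ltr_pdivrMr // mulrC -ltr_pdivrMr //.
  apply: (lt_trans (truncnS_gt _)); apply: le_lt_trans (pow2_gt m).
  by rewrite ler_nat leq_max leqnn orbT.
(* A state (n, p) stands for the partial sum p / 2 ^ n. *)
pose next (x : nat * nat) := (g x.1, x.2 * 2 ^ (g x.1 - x.1) + 1)%N.
pose np i := iter i next (0, 0)%N.
pose n i := (np i).1; pose p i := (np i).2.
have nS i : n i.+1 = g (n i) by [].
have pS i : p i.+1 = (p i * 2 ^ (n i.+1 - n i) + 1)%N by [].
have nlt i : (n i < n i.+1)%N by rewrite nS; case: (gP (n i)).
have ple i : (p i + 1 <= 2 ^ n i)%N.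
  elim: i => [//|i IH]; rewrite pS.
  have -> : (2 ^ n i.+1 = 2 ^ n i * 2 ^ (n i.+1 - n i))%N.
    by rewrite -expnD subnKC // ltnW.
  have : (1 < 2 ^ (n i.+1 - n i))%N by rewrite -[1%N](expn0 2) ltn_exp2l // subn_gt0.
  move: (2 ^ (n i.+1 - n i))%N (2 ^ n i)%N IH => d e IH d1.
  have : (p i * d + d <= e * d)%N by rewrite -mulSnr leq_mul2r -addn1 IH orbT.
  lia.
pose u i : R := (p i)%:R / 2 ^+ n i.
have uS i : u i.+1 = u i + (2 ^+ n i.+1)^-1.
  rewrite /u pS natrD natrM natrX mulrDl mul1r; congr (_ + _).
  have -> : 2 ^+ n i.+1 = 2 ^+ n i * 2 ^+ (n i.+1 - n i) :> R.
    by rewrite -exprD subnKC // ltnW.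
  by field; rewrite !gt_eqF.
have u_lt i : u i < u i.+1 by rewrite uS ltrDl invr_gt0.
have u_homo : {homo u : i k / (i <= k)%N >-> i <= k}.
  by apply/nondecreasing_seqP => i; rewrite ltW.
pose w i := u i + (2 ^+ n i)^-1.
have w_homo : {homo w : i k / (i <= k)%N >-> k <= i}.
  apply/nonincreasing_seqP => i; rewrite /w uS -addrA lerD2l.
  have : 2 ^+ n i * 2 <= 2 ^+ n i.+1 :> R by rewrite -exprSr ler_eXn2l // ltr1n.
  have := pow2_0 (n i); have := pow2_0 (n i.+1).
  move: (2 ^+ n i.+1) (2 ^+ n i) => y x y0 x0 xy.
  have : y^-1 <= (x * 2)^-1 by rewrite lef_pV2 ?posrE ?mulr_gt0.
  rewrite invfM; lra.
have uw i k : u i <= w k.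
  apply: (@le_trans _ _ (u (maxn i k))); first by apply: u_homo; rewrite leq_maxl.
  apply: (@le_trans _ _ (w (maxn i k))); last by apply: w_homo; rewrite leq_maxr.
  by rewrite lerDl invr_ge0 ltW.
have uhs : has_sup (range u).
  split; first by exists (u 0%N), 0%N.
  by exists (w 0%N) => _ [i _ <-].
pose alpha := sup (range u).
have au i : u i < alpha.
  by apply: (lt_le_trans (u_lt i)); apply: (sup_upper_bound uhs); exists i.+1.
have aw i : alpha <= w i.
  by apply: ge_sup; [exists (u 0%N), 0%N | move=> _ [k _ <-]].
have small i : 0 < alpha - u i < h (n i).
  rewrite subr_gt0 au /=; case: (gP (n i)) => _; apply: le_lt_trans.
  rewrite -nS lerBlDr; apply: (le_trans (aw i.+1)).
  by rewrite /w uS; lra.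
have nge i : (i <= n i)%N by elim: i => // i /leq_ltn_trans; apply.
exists alpha; split; last first.
  move=> N; exists (n N), (p N); split => //.
    by have := ple N; lia.
  have /andP[-> /=] := small N; rewrite lt_min => /andP[] //.
(* If alpha = r / s, then s * 2 ^ n_s times the distance to the partial sum of
   index s would be an integer strictly between 0 and 1. *)
move=> [x _ xa]; pose s := `|denq x|%N.
have sE : (s%:R : R) = (denq x)%:~R by rewrite pmulrn abszE gtr0_norm ?denq_gt0.
have s0 : 0 < s%:R :> R by rewrite sE ltr0z denq_gt0.
have := small s; rewrite lt_min => /andP[d0 /andP[_ d1]].
pose z : int := numq x * (2 ^ n s)%:Z - (p s)%:Z * s%:Z.
have zE : z%:~R = (alpha - u s) * (s%:R * 2 ^+ n s) :> R.
  rewrite /z rmorphB !rmorphM /= -!pmulrn natrX -xa /ratr -sE /u.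
  by field; rewrite !gt_eqF.
have : 0 < z%:~R :> R by rewrite zE !mulr_gt0.
have : z%:~R < 1 :> R.
  rewrite zE; apply: (@lt_trans _ _ ((4 ^+ n s)^-1 * (s%:R * 2 ^+ n s))).
    by rewrite ltr_pM2r // mulr_gt0.
  have -> : 4 = 2 * 2 :> R by lra.
  rewrite exprMn invfM.
  have -> : (2 ^+ n s)^-1 * (2 ^+ n s)^-1 * (s%:R * 2 ^+ n s) = s%:R / 2 ^+ n s :> R.
    by field; rewrite gt_eqF.
  rewrite ltr_pdivrMr // mul1r; apply: le_lt_trans (pow2_gt _).
  by rewrite ler_nat.
rewrite ltr0z -[1]/(1%:~R) ltr_int; lia.
Qed.
End Analysis.

(** * Stabilizers in orthogonal groups *)

Section Groups.
Variable R : realType.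

Lemma quad_form_delta d (B : 'M[R]_d) i k : B^T = B ->
  quad_form B (delta_mx i 0 + delta_mx k 0)
  = B i i + B k k + B i k *+ 2.
Proof.
move=> sB; pose b (x y : 'cV[R]_d) := x^T *m B *m y.
have e i' k' : b (delta_mx i' 0) (delta_mx k' 0) 0 0 = B i' k'.
  by rewrite /b trmx_delta -colE -rowE !mxE.
rewrite /quad_form mulmxDr [(_ + _)^T]linearD /= !mulmxDl.
have addE (x y : 'M[R]_1) : (x + y) 0 0 = x 0 0 + y 0 0 by rewrite mxE.
rewrite !addE -!/(b _ _) !e -[in B k i]sB mxE mulr2n; ring.
Qed.

(** Polarization: a symmetric matrix is determined by its quadratic form. *)
Lemma SO_matrixP d (A x : 'M[R]_d) : A^T = A ->
  SO A x <-> \det x = 1 /\ x^T *m A *m x = A.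
Proof.
move=> sA; rewrite /SO /=; split=> -[dx h]; split => //; last first.
  by move=> v; rewrite /quad_form trmx_mul -!mulmxA (mulmxA A) (mulmxA x^T) (mulmxA x^T) h.
pose B := x^T *m A *m x.
have sB : B^T = B by rewrite /B !trmx_mul trmxK sA mulmxA.
have hB v : quad_form B v = quad_form A v.
  by rewrite -h /quad_form /B trmx_mul !mulmxA.
have two0 : 2%:R != 0 :> R by rewrite pnatr_eq0.
have diag i : B i i = A i i.
  have := hB (delta_mx i 0 + delta_mx i 0); rewrite !quad_form_delta //; lra.
apply/matrixP => i k; have := hB (delta_mx i 0 + delta_mx k 0).
rewrite !quad_form_delta // !diag; lra.
Qed.

Lemma lin_form_fixP d (l : 'rV[R]_d) (x : 'M[R]_d) :
  (forall v, lin_form l (x *m v) = lin_form l v) <-> l *m x = l.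
Proof.
rewrite /lin_form; split=> [h|h v]; last by rewrite mulmxA h.
by apply/rowP => i; have := h (delta_mx i 0); rewrite mulmxA -!colE !mxE.
Qed.

Lemma mx_continuous (T : topologicalType) m n (F : T -> 'M[R]_(m, n)) :
  (forall i k, continuous (fun x => F x i k)) -> continuous F.
Proof.
move=> cF x A [P nP sPA].
have : \forall y \near x, forall i k, P i k (F y i k).
  by apply: filter_forall => i; apply: filter_forall => k; apply: cF; apply: nP.
by apply: filterS => y Py; apply: sPA.
Qed.

Lemma mulmx_sandwich_continuous m n p q (P : 'M[R]_(m, n)) (Q : 'M[R]_(p, q)) :
  continuous (fun x : 'M[R]_(n, p) => P *m x *m Q).
Proof.
apply: mx_continuous => i k.
have cP j : continuous (fun x : 'M[R]_(n, p) => (P *m x) i j).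
  under eq_fun do rewrite mxE.
  apply: continuous_big => [|l _ x]; first exact: add_continuous.
  apply: (@continuous_comp _ _ _ (fun x : 'M[R]_(n, p) => x l j) ( *%R (P i l))).
    exact: coord_continuous.
  exact: mulrl_continuous.
under eq_fun do rewrite mxE.
apply: continuous_big => [|j _ x]; first exact: add_continuous.
apply: (@continuous_comp _ _ _ (fun x => (P *m x) i j) ( *%R^~ (Q j k))).
  exact: cP.
exact: mulrr_continuous.
Qed.

Section Stabilizer.
Variables (m : nat) (S : 'M[R]_m).
Hypotheses (symS : S^T = S) (unitS : S \in unitmx).

Local Notation D := (block_mx S 0 0 (- 1%:M) : 'M[R]_(m + 1)).
Local Notation e := (row_mx 0 1%:M : 'rV[R]_(m + 1)).

Lemma sym_block : D^T = D.
Proof. by rewrite tr_block_mx symS !linear0 linearN /= trmx1.  Qed.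

(** Fixing the last coordinate forces the bottom row of [y]; invariance of the
    form then makes the upper right block orthogonal to everything, hence zero. *)
Lemma stab_last_block (y : 'M[R]_(m + 1)) : y^T *m D *m y = D -> e *m y = e ->
  y = block_mx (ulsubmx y) 0 0 1%:M /\ (ulsubmx y)^T *m S *m ulsubmx y = S.
Proof.
move=> yD ey; rewrite -(submxK y) in yD ey.
move: ey; rewrite mul_row_block !mul0mx !mul1mx !add0r => /eq_row_mx[dl dr].
move: yD; rewrite tr_block_mx.
rewrite dl dr !mulmx_block !trmx1 !linear0 /= !(mul0mx, mulmx0, mul1mx, mulmx1, addr0, add0r).
move=> /eq_block_mx[aSa aSb _ _].
have u : (ulsubmx y)^T *m S \in unitmx.
  have : (ulsubmx y)^T *m S *m ulsubmx y \in unitmx by rewrite aSa.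
  by rewrite unitmx_mul => /andP[].
have b0 : ursubmx y = 0 by rewrite -[LHS](mulKmx u) aSb mulmx0.
by split=> //; rewrite -[LHS](submxK y) b0 dl dr.
Qed.

(** Conjugation by [P] carries this stabilizer to that of the last coordinate,
    which is the block copy of SO(S).  Both directions are restrictions of affine
    maps of matrix spaces, hence continuous. *)
Lemma Stab_SO_iso (c s : R) (P Pi : 'M[R]_(m + 1)) : c != 0 -> s != 0 ->
  P *m Pi = 1%:M -> P^T *m D *m P = D ->
  matrix_group_iso (Stab_SO (c *: D) (s *: (e *m P))) (SO S).
Proof.
move=> c0 s0 PPi PDP.
have PiP : Pi *m P = 1%:M by apply: mulmx1C.
have sD := sym_block.
have sc : (c *: D)^T = c *: D by rewrite linearZ /= sD.
have PiDPi : Pi^T *m D *m Pi = D.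
  rewrite -{1}PDP !mulmxA -trmx_mul PPi trmx1 mul1mx -mulmxA PPi mulmx1 //.
have stabP x : Stab_SO (c *: D) (s *: (e *m P)) x <->
    [/\ \det x = 1, x^T *m D *m x = D & e *m P *m x = e *m P].
  rewrite /Stab_SO /=; split.
    move=> [/SO_matrixP -/(_ sc)[dx xD] /lin_form_fixP lx]; split => //.
      by apply: (scalerI c0); rewrite -[RHS]xD -scalemxAr -scalemxAl.
    by apply: (scalerI s0); rewrite -[RHS]lx -scalemxAl.
  move=> [dx xD lx]; split.
    by apply/SO_matrixP => //; split => //; rewrite -scalemxAr -scalemxAl xD.
  by apply/lin_form_fixP; rewrite -scalemxAl lx.
have detPPi : \det P * \det Pi = 1 by rewrite -det_mulmx PPi det1.
pose f (x : 'M[R]_(m + 1)) := ulsubmx (P *m x *m Pi).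
pose g (y : 'M[R]_m) := Pi *m block_mx y 0 0 1%:M *m P.
have fblock x : Stab_SO (c *: D) (s *: (e *m P)) x ->
    P *m x *m Pi = block_mx (f x) 0 0 1%:M /\ (f x)^T *m S *m f x = S.
  move=> /stabP[dx xD lx]; apply: stab_last_block.
    rewrite !trmx_mul -!mulmxA (mulmxA P^T) (mulmxA _ P) PDP.
    by rewrite (mulmxA x^T) (mulmxA _ x) xD (mulmxA _ D) PiDPi.
  by rewrite !mulmxA lx -mulmxA PPi mulmx1.
exists f, g; split.
- move=> x Gx; have [xb fS] := fblock x Gx; have /stabP[dx _ _] := Gx; split.
    apply/SO_matrixP => //; split => //.
    have : \det (P *m x *m Pi) = 1 by rewrite !det_mulmx dx mulr1.
    by rewrite xb det_ublock det1 mulr1.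
  by rewrite /g -xb !mulmxA PiP mul1mx -mulmxA PiP mulmx1.
- move=> y /SO_matrixP -/(_ symS)[dy yS].
  have gy : P *m g y *m Pi = block_mx y 0 0 1%:M.
    by rewrite /g !mulmxA PPi mul1mx -mulmxA PPi mulmx1.
  split; last by rewrite /f gy block_mxKul.
  apply/stabP; split.
  + rewrite /g !det_mulmx mulrAC [\det Pi * _]mulrC detPPi mul1r.
    by rewrite det_ublock dy det1 mulr1.
  + rewrite /g !trmx_mul -!mulmxA (mulmxA Pi^T) (mulmxA _ Pi) PiDPi.
    rewrite (mulmxA _ D) (mulmxA (_ *m D)) tr_block_mx !mulmx_block !trmx1 !linear0 /=.
    rewrite !(mul0mx, mulmx0, mul1mx, mulmx1, addr0, add0r) yS.
    by rewrite mulmxA.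
  + rewrite /g !mulmxA -(mulmxA e) PPi mulmx1 mul_row_block.
    by rewrite !(mul0mx, mulmx0, mul1mx, mulmx1, addr0, add0r).
- move=> x y Gx Gy; have [xb _] := fblock x Gx; have [yb _] := fblock y Gy.
  rewrite {1}/f.
  have -> : P *m (x *m y) *m Pi = (P *m x *m Pi) *m (P *m y *m Pi).
    by rewrite -!mulmxA (mulmxA Pi) PiP mul1mx.
  rewrite xb yb mulmx_block block_mxKul.
  by rewrite !(mul0mx, mulmx0, mul1mx, mulmx1, addr0, add0r).
- apply: continuous_subspaceT; apply: mx_continuous => i k.
  have -> : (fun x => f x i k) =
      (fun y : 'M[R]_(m + 1) => y (lshift 1 i) (lshift 1 k)) \o (fun x => P *m x *m Pi).
    by apply/funext => x; rewrite /f /= !mxE.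
  move=> x; apply: continuous_comp; first exact: mulmx_sandwich_continuous.
  exact: coord_continuous.
apply: continuous_subspaceT.
have -> : g = (fun x => Pi *m x *m P) \o (fun y => block_mx y 0 0 1%:M) by [].
move=> y; apply: continuous_comp; last exact: mulmx_sandwich_continuous.
apply: (mx_continuous _) => i k.
have -> : (fun y => (block_mx y 0 0 1%:M : 'M[R]_(m + 1)) i k) =
   (fun y : 'M[R]_m => block_mx y 0 0 1%:M i k) by [].
case: (split_ordP i) => i' ->; case: (split_ordP k) => k' ->.
- by under eq_fun do rewrite block_mxEul; exact: coord_continuous.
- by under eq_fun do rewrite block_mxEur; exact: cst_continuous.
- by under eq_fun do rewrite block_mxEdl; exact: cst_continuous.
by under eq_fun do rewrite block_mxEdr; exact: cst_continuous.
Qed.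

End Stabilizer.
End Groups.

(** * Eichler transvections *)

Section Transvection.
Variables (R : realType) (d : nat) (D : 'M[R]_d).
Variables (xi omega : 'rV[R]_d) (u w : 'cV[R]_d).
Hypotheses (symD : D^T = D) (Du : D *m u = - xi^T) (Dw : D *m w = - omega^T).
Hypotheses (xiu : xi *m u = 0) (xiw : xi *m w = 0).
Hypotheses (ou : omega *m u = 0) (ow : omega *m w = 1%:M).

(** The hypotheses make [u] isotropic and orthogonal to [w], with [w] of norm -1,
    and [xi], [omega] the forms that are minus the pairings with [u] and [w].
    This is the Eichler transvection attached to [u] and [w], written without
    coordinates. *)
Definition transvection (alpha : R) : 'M[R]_d :=
  1%:M + u *m (alpha *: omega - (alpha ^+ 2 / 2) *: xi) - alpha *: (w *m xi).

Lemma last_row_transvection alpha : omega *m transvection alpha = omega - alpha *: xi.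
Proof.
rewrite /transvection mulmxBr mulmxDr mulmx1 mulmxA ou mul0mx addr0.
by rewrite -scalemxAr mulmxA ow mul1mx.
Qed.

Lemma xi_transvection alpha : xi *m transvection alpha = xi.
Proof.
rewrite /transvection mulmxBr mulmxDr mulmx1 mulmxA xiu mul0mx addr0.
by rewrite -scalemxAr mulmxA xiw mul0mx scaler0 subr0.
Qed.

Lemma transvectionN alpha : transvection alpha *m transvection (- alpha) = 1%:M.
Proof.
rewrite {1}/transvection mulmxBl mulmxDl mul1mx -mulmxA mulmxBl -!scalemxAl.
rewrite last_row_transvection xi_transvection -mulmxA xi_transvection.
rewrite /transvection !mulmxBr -!scalemxAr !mulmxBr -!scalemxAr.
by apply/matrixP => i k; rewrite !mxE; field.
Qed.

Lemma transvection_preserves alpha :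
  (transvection alpha)^T *m D *m transvection alpha = D.
Proof.
have uD : u^T *m D = - xi by rewrite -[D]symD -trmx_mul Du linearN /= trmxK.
have wD : w^T *m D = - omega by rewrite -[D]symD -trmx_mul Dw linearN /= trmxK.
have -> : (transvection alpha)^T = 1%:M
    + (alpha *: omega^T - (alpha ^+ 2 / 2) *: xi^T) *m u^T - alpha *: (xi^T *m w^T).
  by rewrite /transvection [(_ - _)^T]linearB /= [(_ + _)^T]linearD /= trmx1 ![(_ *: _)^T]linearZ /= !trmx_mul
    [(_ - _)^T]linearB /= ![(_ *: _)^T]linearZ /=.
rewrite -mulmxA mulmxBl mulmxDl mul1mx -!mulmxA -!scalemxAl -!mulmxA.
rewrite !(mulmxA _ D) uD wD !mulNmx xi_transvection last_row_transvection.
rewrite {1}/transvection mulmxBr mulmxDr mulmx1 -scalemxAr !mulmxA Du Dw.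
rewrite !mulNmx !mulmxN !mulmxBl !mulmxBr -!scalemxAl -!scalemxAr.
by apply/matrixP => i k; rewrite !mxE; field.
Qed.
End Transvection.

(** * Counting integer points of bounded norm *)

Section Counting.
Variable R : realType.

(** Finiteness is essential: [fset_set] sends infinite sets to the empty set. *)
Lemma size_le_card_fset_set (T : choiceType) (A : set T) (s : seq T) :
  finite_set A -> uniq s -> (forall x, x \in s -> A x) ->
  (size s <= #|` fset_set A|)%N.
Proof.
move=> fA us sA; apply: uniq_leq_size => // x xs.
by rewrite in_fset_set // inE; apply: sA.
Qed.

Lemma finite_bounded_int_vec d (N : nat) :
  finite_set [set v : 'cV[int]_d | forall i, (`|v i 0%R| <= N)%N].
Proof.
pose f (x : 'cV['I_(N + N).+1]_d) : 'cV[int]_d := \col_i ((x i 0 : nat)%:Z - N%:Z).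
apply: (@sub_finite_set _ _ (f @` setT)); last first.
  by apply: finite_image; apply: finite_finset.
move=> v /= vN; exists (\col_i inord `|(v i 0 + N%:Z)%R|%N) => //.
apply/colP => i; rewrite !mxE inordK; have := vN i; lia.
Qed.

Lemma finite_int_points d (A : 'M[R]_d) l a b1 b2 T : finite_set (int_points A l a b1 b2 T).
Proof.
apply: (sub_finite_set _ (@finite_bounded_int_vec d (Num.truncn T))).
move=> v [_ _ vT] i /=; have T0 : 0 <= T by apply: le_trans vT; apply: sqrtr_ge0.
rewrite truncn_ge_nat // pmulrn abszE intr_norm; apply: le_trans vT.
rewrite -sqrtr_sqr ler_wsqrtr // (bigD1 i) //= mxE lerDl.
by apply: sumr_ge0 => k _; apply: sqr_ge0.
Qed.

Lemma euclid_norm_le d (v : 'cV[R]_d) (B : R) : 0 <= B ->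
  (forall i, `|v i 0| <= B) -> euclid_norm v <= d%:R * B.
Proof.
move=> B0 vB; have dB : 0 <= d%:R * B by rewrite mulr_ge0.
rewrite /euclid_norm -[leRHS]ger0_norm // -sqrtr_sqr ler_wsqrtr //.
apply: (@le_trans _ _ (\sum_(i < d) B ^+ 2)).
  apply: ler_sum => i _; rewrite -real_normK ?num_real //.
  by rewrite lerXn2r ?nnegrE.
rewrite sumr_const card_ord -[leLHS]mulr_natl exprMn ler_wpM2r ?sqr_ge0 //.
by rewrite -natrX ler_nat; case: (d) => // n; rewrite -mulnn leq_pmulr.
Qed.

End Counting.

(** * The forms and the proof of the theorem *)

Section Assembly.
Variables (R : realType) (j' : nat).
Local Notation j := j'.+1.
Local Notation d := (j + 2 + 1)%N.

Definition signature_mx : 'M[R]_(j + 2) := block_mx 1%:M 0 0 (- 1%:M).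
Definition ambient_mx : 'M[R]_d := block_mx signature_mx 0 0 (- 1%:M).

Definition isotropic_row : 'rV[R]_d := row_mx (row_mx (- delta_mx 0 0) (delta_mx 0 0)) 0.
Definition last_row : 'rV[R]_d := row_mx 0 1%:M.
Definition isotropic_col : 'cV[R]_d := col_mx (col_mx (delta_mx 0 0) (delta_mx 0 0)) 0.
Definition last_col : 'cV[R]_d := col_mx 0 1%:M.

Lemma signature_mx_sym : signature_mx^T = signature_mx.
Proof. by rewrite tr_block_mx !linear0 linearN /= !trmx1. Qed.

Lemma signature_mx_unit : signature_mx \in unitmx.
Proof.
have : signature_mx *m signature_mx = 1%:M.
  rewrite mulmx_block !(mul0mx, mulmx0, mul1mx, mulmx1, addr0, add0r).
  by rewrite mulmxN mulNmx mulmx1 opprK -scalar_mx_block.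
by move=> /mulmx1_unit[].
Qed.

Lemma ambient_mx_unit : ambient_mx \in unitmx.
Proof.
rewrite unitmxE det_ublock unitrM -unitmxE signature_mx_unit /=.
by rewrite -scaleN1r detZ det1 expr1 mulr1 unitrN unitr1.
Qed.

(** The sign [s] will be chosen so that the values [- s * delta * X] have the sign
    of the target interval. *)
Definition approx_form (s alpha : R) : 'rV[R]_d := s *: (last_row - alpha *: isotropic_row).

Lemma approx_form_Stab_iso (c s alpha : R) : c != 0 -> s != 0 ->
  matrix_group_iso (Stab_SO (c *: ambient_mx) (approx_form s alpha)) (@SOpq R j 2).
Proof.
move=> c0 s0.
have sD : ambient_mx^T = ambient_mx := sym_block signature_mx_sym.
have Du : ambient_mx *m isotropic_col = - isotropic_row^T.
  rewrite /ambient_mx /isotropic_col /isotropic_row !tr_row_mx !linear0 linearN /= !trmx_delta.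
  rewrite !opp_col_mx opprK oppr0 mul_block_col mul_block_col.
  by rewrite !(mul0mx, mulmx0, mul1mx, mulNmx, addr0, add0r).
have Dw : ambient_mx *m last_col = - last_row^T.
  rewrite /ambient_mx /last_col /last_row tr_row_mx linear0 trmx1 opp_col_mx oppr0.
  by rewrite mul_block_col !(mul0mx, mulmx0, mul1mx, mulNmx, addr0, add0r).
have xiu : isotropic_row *m isotropic_col = 0.
  rewrite /isotropic_row /isotropic_col !mul_row_col mul0mx addr0 mulNmx !mul_delta_mx.
  by rewrite addrC subrr.
have xiw : isotropic_row *m last_col = 0 by rewrite mul_row_col mulmx0 mul0mx addr0.
have ou : last_row *m isotropic_col = 0 by rewrite mul_row_col mulmx0 mul0mx addr0.
have ow : last_row *m last_col = 1%:M by rewrite mul_row_col mulmx0 mul1mx add0r.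
rewrite /approx_form -(last_row_transvection isotropic_row ou ow).
apply: (Stab_SO_iso signature_mx_sym signature_mx_unit c0 s0).
  exact: transvectionN xiu xiw ou ow alpha.
exact: transvection_preserves sD Du Dw xiu xiw ou ow alpha.
Qed.

(** The quotient of two coefficients is [alpha], up to sign. *)
Lemma approx_form_irrational (s alpha : R) : s != 0 -> ~ rational alpha ->
  irrational_lin_form (approx_form s alpha).
Proof.
move=> s0 irr c c0 rat; apply: irr.
have [x _ xE] := rat (rshift _ 0); have [y _ yE] := rat (lshift 1 (lshift 2 0)).
have coef (o t : 'rV[R]_d) i : (c *: (s *: (o - alpha *: t))) 0 i =
    c * (s * (o 0 i - alpha * t 0 i)) by rewrite !mxE.
move: xE yE; rewrite !coef /isotropic_row /last_row !row_mxEr !row_mxEl.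
have -> : (- delta_mx 0 0 : 'rV[R]_j) 0 0 = -1 by rewrite !mxE.
have -> : (1%:M : 'M[R]_1) 0 0 = 1 by rewrite !mxE.
have z m k : (0 : 'rV[R]_m) 0 k = 0 by rewrite mxE.
rewrite !z mulr0 subr0 sub0r mulrN1 opprK !mulr1 => xE yE.
exists (y / x) => //; rewrite fmorph_div /= xE yE.
by field; rewrite c0 s0.
Qed.

Lemma ambient_mx_rational (c : rat) : rational_quad_form (ratr c *: ambient_mx).
Proof.
move=> i k; pose B : 'M[rat]_d := block_mx (block_mx 1%:M 0 0 (- 1%:M)) 0 0 (- 1%:M).
have -> : ambient_mx = map_mx ratr B.
  by rewrite !map_block_mx !map_mxN !map_mx1 !map_mx0.
by exists (c * B i k) => //; rewrite !mxE rmorphM.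
Qed.

Lemma quad_form_ambient (c : R) (v : 'cV[R]_d) :
  quad_form (c *: ambient_mx) v = c * diag_form v.
Proof.
have sq n (a : 'cV[R]_n) : (a^T *m a) 0 0 = \sum_i a i 0 ^+ 2.
  by rewrite mxE; apply: eq_bigr => i _; rewrite mxE expr2.
rewrite -(vsubmxK v) -(vsubmxK (usubmx v)).
move: (usubmx (usubmx v)) (dsubmx (usubmx v)) (dsubmx v) => a b w.
rewrite /quad_form -scalemxAr -scalemxAl mxE; congr (_ * _).
rewrite !tr_col_mx !mul_row_block !mul_row_col
  !(mul0mx, mulmx0, mulmx1, mulmxN, mulNmx, addr0, add0r).
rewrite mul_row_col mulNmx /diag_form.
have addE (x y : 'M[R]_1) : (x - y) 0 0 = x 0 0 - y 0 0 by rewrite !mxE.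
rewrite !addE !sq big_ord1 col_mxEd; congr (_ - _ - _).
  by apply: eq_bigr => i _; rewrite !col_mxEu.
by apply: eq_bigr => i _; rewrite col_mxEu col_mxEd.
Qed.

Lemma diag_form_int (v : 'cV[int]_d) : diag_form (int_vec R v) = (diag_form v)%:~R.
Proof.
rewrite /diag_form !rmorphB !rmorph_sum /= rmorphXn mxE; congr (_ - _ - _).
  by apply: eq_bigr => i _; rewrite mxE rmorphXn.
by apply: eq_bigr => i _; rewrite mxE rmorphXn.
Qed.

Lemma lin_form_approx (s alpha : R) (v : 'cV[int]_d) :
  lin_form (approx_form s alpha) (int_vec R v)
  = s * ((last_coord v)%:~R - alpha * (isotropic_coord v)%:~R).
Proof.
pose x := int_vec R v.
have ox : (last_row *m x) 0 0 = (last_coord v)%:~R.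
  rewrite -(vsubmxK x) mul_row_col mul0mx mul1mx add0r mxE.
  by rewrite /x !mxE.
have xx : (isotropic_row *m x) 0 0 = (isotropic_coord v)%:~R.
  rewrite -(vsubmxK x) -(vsubmxK (usubmx x)) !mul_row_col mul0mx addr0 mulNmx.
  by rewrite -!rowE !mxE /isotropic_coord rmorphB /= addrC.
by rewrite /lin_form /approx_form -scalemxAl mulmxBl -scalemxAl -/x -ox -xx !mxE.
Qed.

Variables (a1 : rat) (e : int) (eps : R).
Hypotheses (a10 : 0 < a1) (eps0 : 0 < eps).
Hypothesis many_points : forall (n : nat) (b1 b2 : R), 0 < b1 -> b1 < b2 ->
  exists kappa K Y0 : R, [/\ 0 < kappa, 0 < K, 1 <= Y0 &
    forall (p : nat) (Y : R), (p <= 2 ^ n)%N -> Y0 <= Y ->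
    exists s : seq 'cV[int]_d, [/\ uniq s,
      kappa * (Y ^+ j * ln Y) <= (size s)%:R &
      forall v, v \in s ->
        good_point p (2 ^ n) e (b1 * Y) (b2 * Y) (K * Y) v]].

Local Notation A := (ratr (- a1) *: ambient_mx).
Local Notation a := (ratr (- a1) * e%:~R : R).

(** The section at [p / 2 ^ n] is used at the scale [Y = 1 / delta], where
    [delta = alpha - p / 2 ^ n] makes [alpha]'s form take values of order 1 on
    points of size [Y]. *)
Lemma many_points_near_rational (n : nat) (b1 b2 c1 c2 s : R) :
  0 < b1 -> b1 < b2 -> (forall x, b1 <= x <= b2 -> c1 <= - (s * x) <= c2) ->
  exists f : R, 0 < f /\ forall (p : nat) (alpha : R), (p <= 2 ^ n)%N ->
    0 < alpha - p%:R / 2 ^+ n < f ->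
    exists T : R, n%:R <= T /\ T ^+ j * (ln T `^ (1 - eps))
      < (#|` fset_set (int_points A (approx_form s alpha) a c1 c2 T)|)%:R.
Proof.
move=> b10 b12 hs; have [kappa [K [Y0 [k0 K0 Y01 MP]]]] := many_points n b10 b12.
pose K' := d%:R * K + 1.
have K'1 : 1 <= K' by rewrite /K' lerDr mulr_ge0 // ltW.
have [Y1 hY1] := powR_ln_lt j eps0 k0 K'1.
pose M := Num.max (Num.max Y0 Y1) n%:R.
have M0 : 0 < M by rewrite !lt_max; apply/orP; left; apply/orP; left; lra.
exists M^-1; split; first by rewrite invr_gt0.
move=> p alpha pn; set delta := alpha - _ => /andP[d0 dM].
pose Y := delta^-1.
have MY : M <= Y by rewrite /Y -[M]invrK lef_pV2 ?posrE ?invr_gt0 // ltW.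
have Ypos : 0 < Y by rewrite invr_gt0.
move: (MY); rewrite !ge_max => /andP[/andP[Y0Y Y1Y] nY].
have [l [ul sl gl]] := MP p Y pn Y0Y.
exists (K' * Y); split; first by apply: (le_trans nY); rewrite ler_peMl // ltW.
apply: (lt_le_trans (hY1 _ Y1Y)); apply: (le_trans sl); rewrite ler_nat.
apply: size_le_card_fset_set => //; first exact: finite_int_points.
move=> v /gl[ve vp /andP[v1 v2] vB]; split.
- by rewrite quad_form_ambient diag_form_int ve.
- rewrite lin_form_approx; set w : R := (last_coord v)%:~R; set x : R := (isotropic_coord v)%:~R.
  have -> : w - alpha * x = - (delta * x).
    have : w * 2 ^+ n = x * p%:R.
      have := congr1 (fun z : int => z%:~R : R) vp.
      by rewrite !rmorphM /= -!pmulrn natrX.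
    have n0 : 2 ^+ n != 0 :> R by rewrite expf_neq0.
    move=> /(canRL (mulfK n0)) ->; rewrite /delta; field.
    exact: n0.
  rewrite mulrN; apply: hs.
  by rewrite -(ler_pdivrMl _ _ d0) -(ler_pdivlMl _ _ d0) -/Y mulrC v1 mulrC.
have KY : 0 <= K * Y by rewrite mulr_ge0 // ltW.
apply: (le_trans (euclid_norm_le KY _)) => [i|]; first by rewrite mxE; apply: vB.
by rewrite mulrA ler_wpM2r ?(ltW Ypos) // lerDl.
Qed.

Lemma many_points_liouville_form (b1 b2 : R) : b1 < b2 ->
  exists l : 'rV[R]_d,
    [/\ nondegenerate_quad_form A, rational_quad_form A, irrational_lin_form l,
        matrix_group_iso (Stab_SO A l) (@SOpq R j 2) &
        exists T : nat -> R, T @ \oo --> +oo /\ forall k : nat,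
            T k ^+ j * (ln (T k) `^ (1 - eps))
              < (#|` fset_set (int_points A l a b1 b2 (T k)) |)%:R ].
Proof.
move=> b12.
(* On the points used the form is nonzero and of constant sign, so the interval
   is first replaced by a subinterval that avoids 0. *)
have [s [c1 [c2 [s0 c10 c12 hs]]]] : exists s c1 c2 : R,
    [/\ s != 0, 0 < c1, c1 < c2 & forall x, c1 <= x <= c2 -> b1 <= - (s * x) <= b2].
  have [b20|b20] := ltP 0 b2.
    exists (-1), (Num.max b1 (b2 / 2)), b2; split.
    - by rewrite oppr_eq0 oner_eq0.
    - by rewrite lt_max; apply/orP; right; lra.
    - by rewrite gt_max b12; lra.
    by move=> x; rewrite ge_max => /andP[/andP[? ?] ?]; lra.
  exists 1, (Num.max (- b2) (- b1 / 2)), (- b1); split.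
  - by rewrite oner_eq0.
  - by rewrite lt_max; apply/orP; right; lra.
  - by rewrite gt_max; apply/andP; split; lra.
  by move=> x; rewrite ge_max => /andP[/andP[? ?] ?]; lra.
have /choice[f fP] n := many_points_near_rational n c10 c12 hs.
have [alpha [irr approx]] := liouville_exists (fun n => (fP n).1).
have a1n0 : ratr (- a1) != 0 :> R by rewrite fmorph_eq0 oppr_eq0 gt_eqF.
exists (approx_form s alpha); split.
- split; first by rewrite linearZ /= (sym_block signature_mx_sym).
  by rewrite unitmxZ ?unitfE // ambient_mx_unit.
- exact: ambient_mx_rational.
- exact: approx_form_irrational.
- exact: approx_form_Stab_iso.
have /choice[T TP] k : exists T : R, k%:R <= T /\ T ^+ j * (ln T `^ (1 - eps))
    < (#|` fset_set (int_points A (approx_form s alpha) a b1 b2 T)|)%:R.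
  have [n [p [kn pn dn]]] := approx k.
  have [T [nT TT]] := (fP n).2 p alpha pn dn.
  by exists T; split => //; apply: le_trans nT; rewrite ler_nat.
exists T; split; last by move=> k; case: (TP k).
apply/cvgryPge => B; near=> k.
apply: (@le_trans _ _ k%:R); last by case: (TP k).
near: k; exact: nbhs_infty_ger.
Unshelve. all: by end_near. Qed.
End Assembly.

Theorem theorem6p2 (R : realType) (j : nat) (hj : j = 1%N \/ j = 2%N)
    (a1 a2 : rat) (ha1 : 0 < a1) (ha2 : a2 = 0)
    (eps : R) (heps : 0 < eps) (b1 b2 : R) (hb : b1 < b2) :
  exists (d : nat) (A : 'M[R]_d) (l : 'rV[R]_d),
    [/\ nondegenerate_quad_form A,
        rational_quad_form A,
        irrational_lin_form l,
        matrix_group_iso (Stab_SO A l) (@SOpq R j 2) &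
        exists T : nat -> R,
          T @ \oo --> +oo /\
          forall k : nat,
            T k ^+ j * (ln (T k) `^ (1 - eps))
              < (#|` fset_set (int_points A l
                   (ratr (if j == 1%N then a1 else a2)) b1 b2 (T k)) |)%:R ].
Proof.
case: hj => -> /=.
  have [l H] := many_points_liouville_form ha1 heps (@many_points1 R) hb.
  have -> : ratr a1 = ratr (- a1) * (-1)%:~R :> R by rewrite mulrNz mulr1z rmorphN /= mulrNN mulr1.
  by exists (1 + 2 + 1)%N, (ratr (- a1) *: ambient_mx R 0), l.
have [l H] := many_points_liouville_form ha1 heps (@many_points2 R) hb.
have -> : ratr a2 = ratr (- a1) * 0%:~R :> R by rewrite ha2 mulr0 raddf0.
by exists (2 + 2 + 1)%N, (ratr (- a1) *: ambient_mx R 1), l.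
Qed.
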